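(* For the heterogeneous one-velocity one-temperature binary mixture of stiffened gases described in the context, the following formula for the squared speed of sound holds: $$c_s^2:=\partial_\rho p_+ +\frac{p_+}{\rho^2}\,\partial_\varepsilon p_+=\frac{\gamma(p_+ +p_{*1})(p_+ +p_{*2})}{\rho\sqrt{d}}>0,$$ where the derivatives $\partial_\rho$ and $\partial_\varepsilon$ of $p_+=\tfrac12(b+\sqrt d)$ are taken under the assumption that $\varepsilon_0$ and $\sigma^{(k)}$, $k=1,2$, are constant in the expressions for $b$ and $c$. Moreover, for smooth solutions of the system of balance PDEs given in the context, the following balance PDE for $p_+$ holds: $$\partial_tp_+ +\mathbf{u}\cdot\nabla p_+ +\rho c_s^2\,\mathrm{div}\,\mathbf{u}=\frac{c_s^2}{\gamma c_V\theta}\big(\mathrm{div}(-\mathbf{q}^F)+\Pi^{NS}:\nabla\mathbf{u}+Q\big).$$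
   Context: $\langle\cdot\rangle$ denotes summation over $k=1,2$. Physical constants for $k=1,2$: $c_{Vk}>0$, $\gamma_k>1$, $R_k=(\gamma_k-1)c_{Vk}>0$, $p_{*k}\geq 0$, $\varepsilon_{0k}\in\mathbb{R}$. A binary stiffened-gas mixture state consists of component densities $r_k>0$, volume fractions $0<\alpha_k<1$ ($k=1,2$) and a temperature $\theta>0$ such that $\alpha_1+\alpha_2=1$ and the component pressures $p_k=R_kr_k\theta-p_{*k}$ are equal to a common pressure: $p=p_1=p_2>0$. The component specific internal energies are $\varepsilon_k=c_{Vk}\theta+p_{*k}/r_k+\varepsilon_{0k}$. Put $\rho_k=\alpha_kr_k$, $\rho=\langle\rho_k\rangle$, and define $\varepsilon,\varepsilon_0,R,c_V,\gamma$ by $\rho\varepsilon=\langle\rho_k\varepsilon_k\rangle$, $\rho\varepsilon_0=\langle\rho_k\varepsilon_{0k}\rangle$, $\rho R=\langle R_k\rho_k\rangle$, $\rho c_V=\langle c_{Vk}\rho_k\rangle$, $\gamma=R/c_V+1$. Put $\sigma^{(k)}=\dfrac{R_k\rho_k}{c_V\rho}$, so $\langle\sigma^{(k)}\rangle=\gamma-1$, and $$b=\langle\sigma^{(k)}(\rho(\varepsilon-\varepsilon_0)-p_{*k})-p_{*k}\rangle,\qquad c=(\sigma^{(1)}p_{*2}+\sigma^{(2)}p_{*1})\rho(\varepsilon-\varepsilon_0)-\gamma p_{*1}p_{*2},\qquad d=b^2+4c.$$ It is known that $d>0$ and that the common pressure is $p=p_+:=\tfrac12(b+\sqrt d)$.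 In the definition of $c_s^2$, $b$ and $c$ (hence $p_+$) are regarded as functions of $(\rho,\varepsilon)$ with $\varepsilon_0,\sigma^{(1)},\sigma^{(2)}$ (hence also $\gamma=1+\langle\sigma^{(k)}\rangle$) held fixed. System of PDEs: the component densities $r_k$ and volume fractions $\alpha_k$ ($k=1,2$), the temperature $\theta$ (hence also $\rho_k$, $\rho$, $p_k$, $p=p_+$, $\varepsilon_k$, $\varepsilon$, $\varepsilon_0$, $R$, $c_V$, $\gamma$, $\sigma^{(k)}$, $b$, $c$, $d$) and the velocity $\mathbf{u}$ are functions of $x\in\Omega\subset\mathbb{R}^n$ ($n=1,2,3$) and $t\ge0$ satisfying $$\partial_t\rho_k+\mathrm{div}(\rho_k\mathbf{u})=0,\ k=1,2,$$ $$\partial_t(\rho\mathbf{u})+\mathrm{div}(\rho\mathbf{u}\otimes\mathbf{u})+\nabla p=\mathrm{div}\,\Pi^{NS}+\rho\mathbf{f},$$ $$\partial_t\big(\tfrac12\rho|\mathbf{u}|^2+\rho\varepsilon\big)+\mathrm{div}\big((\tfrac12\rho|\mathbf{u}|^2+\rho\varepsilon+p)\mathbf{u}\big)=\mathrm{div}(-\mathbf{q}^F+\Pi^{NS}\mathbf{u})+\rho\mathbf{u}\cdot\mathbf{f}+Q,$$ with $\Pi^{NS}=\mu(\nabla\mathbf{u}+(\nabla\mathbf{u})^T)+(\lambda-\tfrac23\mu)(\mathrm{div}\,\mathbf{u})\mathbb{I}$ and $-\mathbf{q}^F=\varkappa\nabla\theta$, where $\mu,\lambda,\varkappa\ge0$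 may depend on the unknown functions, $\mathbf{f}$ is a given body force density and $Q\ge0$ a given heat source intensity. Here $\nabla\mathbf{u}=\{\partial_iu_j\}_{i,j=1}^n$, the divergence of a tensor is taken with respect to its first index, and $:$ is the scalar product of tensors. *)

(* Defs.v *)
From mathcomp Require Import all_boot all_order all_algebra.
From mathcomp Require Import all_classical all_reals all_analysis.

Set Implicit Arguments.
Unset Strict Implicit.
Unset Printing Implicit Defensive.

Import Order.TTheory GRing.Theory Num.Theory.
Import numFieldNormedType.Exports.

Local Open Scope classical_set_scope.
Local Open Scope ring_scope.

(* Binary mixtures of stiffened gases. The two components are indexed by 'I_2. *)

Record stiffened_gas (R : realType) := StiffenedGas {
  c_V : R;
  adiab : R;
  p_star : R;
  eps_0 : R;
  c_V_gt0 : 0 < c_V;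
  adiab_gt1 : 1 < adiab;
  p_star_ge0 : 0 <= p_star
}.

Definition R_gas (R : realType) (a : stiffened_gas R) : R :=
  (adiab a - 1) * c_V a.

Definition c1 : 'I_2 := ord0.
Definition c2 : 'I_2 := ord_max.

Record mix_state (R : realType) := MixState {
  dens : 'I_2 -> R;
  vfrac : 'I_2 -> R;
  temp : R
}.

Section Mixture.
Context {R : realType} (g : 'I_2 -> stiffened_gas R).
Implicit Types (s : mix_state R) (k : 'I_2) (sig : 'I_2 -> R).

Definition comp_pressure s k : R :=
  R_gas (g k) * dens s k * temp s - p_star (g k).

Definition comp_energy s k : R :=
  c_V (g k) * temp s + p_star (g k) / dens s k + eps_0 (g k).

Definition admissible s : Prop :=
  [/\ forall k, 0 < dens s k,
      forall k, 0 < vfrac s k < 1,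
      0 < temp s,
      \sum_k vfrac s k = 1
    & comp_pressure s c1 = comp_pressure s c2 /\ 0 < comp_pressure s c1].

(* The common pressure, which is meaningful for an admissible state. *)
Definition pressure s : R := comp_pressure s c1.

Definition pdens s k : R := vfrac s k * dens s k.
Definition rho s : R := \sum_k pdens s k.
Definition eps s : R := (\sum_k pdens s k * comp_energy s k) / rho s.
Definition eps0 s : R := (\sum_k pdens s k * eps_0 (g k)) / rho s.
Definition Rmix s : R := (\sum_k R_gas (g k) * pdens s k) / rho s.
Definition cVmix s : R := (\sum_k c_V (g k) * pdens s k) / rho s.
Definition gam s : R := Rmix s / cVmix s + 1.
Definition sigma s k : R := R_gas (g k) * pdens s k / (cVmix s * rho s).

(* b, c, d and p_+ as functions of the mixture density r and the mixture      *)
(* specific internal energy e; the parameters sig, ga, e0 stand for           *)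
(* sigma^(k), gamma, eps_0, which are frozen in the definition of c_s^2.      *)
Definition b_fun sig (e0 r e : R) : R :=
  \sum_k (sig k * (r * (e - e0) - p_star (g k)) - p_star (g k)).

Definition c_fun sig (ga e0 r e : R) : R :=
  (sig c1 * p_star (g c2) + sig c2 * p_star (g c1)) * (r * (e - e0))
  - ga * p_star (g c1) * p_star (g c2).

Definition d_fun sig (ga e0 r e : R) : R :=
  b_fun sig e0 r e ^+ 2 + 4 * c_fun sig ga e0 r e.

Definition p_plus_fun sig (ga e0 r e : R) : R :=
  2^-1 * (b_fun sig e0 r e + Num.sqrt (d_fun sig ga e0 r e)).

Definition d_mix s : R := d_fun (sigma s) (gam s) (eps0 s) (rho s) (eps s).

Definition p_plus s : R :=
  p_plus_fun (sigma s) (gam s) (eps0 s) (rho s) (eps s).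

Definition p_plus_of_rho s : R -> R :=
  fun r => p_plus_fun (sigma s) (gam s) (eps0 s) r (eps s).

Definition p_plus_of_eps s : R -> R :=
  fun e => p_plus_fun (sigma s) (gam s) (eps0 s) (rho s) e.

Definition cs2 s : R :=
  derive1 (p_plus_of_rho s) (rho s)
  + p_plus s / rho s ^+ 2 * derive1 (p_plus_of_eps s) (eps s).

End Mixture.

Section Calculus.
Context {R : realType} {n : nat}.
Implicit Types (h : R -> R) (phi : 'rV[R]_n -> R) (v : 'rV[R]_n -> 'rV[R]_n)
  (T : 'rV[R]_n -> 'M[R]_n) (x : 'rV[R]_n).

(* Derivative in time on [0, +oo[: two-sided for t > 0, one-sided at t = 0. *)
Definition dt_quot h (t : R) : set_system R :=
  (fun tau => tau^-1 * (h (t + tau) - h t))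
    @ within [set tau | 0 <= t + tau] 0^'.
Definition dt_derivable h (t : R) : Prop := cvg (dt_quot h t).
Definition dt h (t : R) : R := lim (dt_quot h t).

Definition partial_derivable phi x : Prop :=
  forall i : 'I_n, derivable phi x 'e_i.

Definition grad phi x : 'rV[R]_n := \row_i 'D_('e_i) phi x.

(* (grad u)_{ij} = d_i u_j *)
Definition vgrad v x : 'M[R]_n :=
  \matrix_(i, j) 'D_('e_i) (fun y => v y 0 j) x.

Definition div v x : R := \sum_i 'D_('e_i) (fun y => v y 0 i) x.

(* The divergence of a tensor is taken with respect to its first index. *)
Definition tdiv T x : 'rV[R]_n :=
  \row_j \sum_i 'D_('e_i) (fun y => T y i j) x.

Definition dotv (a b : 'rV[R]_n) : R := \sum_i a 0 i * b 0 i.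
Definition ddot (A B : 'M[R]_n) : R := \sum_i \sum_j A i j * B i j.
Definition tensor (a b : 'rV[R]_n) : 'M[R]_n := \matrix_(i, j) (a 0 i * b 0 j).
(* A a, with vectors written as rows *)
Definition app_mx (A : 'M[R]_n) (a : 'rV[R]_n) : 'rV[R]_n := a *m A^T.

End Calculus.

Section BalanceSystem.
Context {R : realType} {n : nat}.
Context (g : 'I_2 -> stiffened_gas R).
Context (Omega : set 'rV[R]_n).

(* Fields depending on time and position; only their values for t >= 0 and    *)
(* x in Omega matter. The viscosities mu, lambda and the heat conductivity    *)
(* kappa are arbitrary nonnegative fields, so they may depend on the unknowns *)
(* in any way.                                                                *)
Context (w : R -> 'rV[R]_n -> mix_state R).
Context (u : R -> 'rV[R]_n -> 'rV[R]_n).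
Context (mu lambda kappa : R -> 'rV[R]_n -> R).
Context (f : R -> 'rV[R]_n -> 'rV[R]_n).
Context (Q : R -> 'rV[R]_n -> R).

Definition PiNS t x : 'M[R]_n :=
  mu t x *: (vgrad (u t) x + (vgrad (u t) x)^T)
  + ((lambda t x - 2 / 3 * mu t x) * div (u t) x)%:M.

Definition qF t x : 'rV[R]_n :=
  - (kappa t x *: grad (fun y => temp (w t y)) x).

Definition kinetic t x : R := 2^-1 * rho (w t x) * dotv (u t x) (u t x).
Definition internal t x : R := rho (w t x) * eps g (w t x).

(* Existence of the first-order partial derivatives. *)
Definition smooth1 (phi : R -> 'rV[R]_n -> R) : Prop :=
  forall t x, 0 <= t -> Omega x ->
    dt_derivable (fun tau => phi tau x) t /\ partial_derivable (phi t) x.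

(* Smoothness of a solution: all the derivatives occurring in the system      *)
(* exist. This is implied by any C^m-smoothness of the unknowns and of the    *)
(* transport coefficients that makes sense of the system, and no continuity   *)
(* of the derivatives is required.                                            *)
Record smooth_fields : Prop := SmoothFields {
  smooth_dens : forall k, smooth1 (fun t x => dens (w t x) k);
  smooth_vfrac : forall k, smooth1 (fun t x => vfrac (w t x) k);
  smooth_temp : smooth1 (fun t x => temp (w t x));
  smooth_velocity : forall j, smooth1 (fun t x => u t x 0 j);
  smooth_PiNS : forall t x, 0 <= t -> Omega x ->
    forall i j, partial_derivable (fun y => PiNS t y i j) x;
  smooth_qF : forall t x, 0 <= t -> Omega x ->
    forall i, partial_derivable (fun y => qF t y 0 i) x
}.

Definition mass_balance t x : Prop := forall k : 'I_2,
  dt (fun tau => pdens (w tau x) k) t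
  + div (fun y => pdens (w t y) k *: u t y) x = 0.

Definition momentum_balance t x : Prop :=
  \row_j dt (fun tau => (rho (w tau x) *: u tau x) 0 j) t
  + tdiv (fun y => rho (w t y) *: tensor (u t y) (u t y)) x
  + grad (fun y => pressure g (w t y)) x
  = tdiv (PiNS t) x + rho (w t x) *: f t x.

Definition energy_balance t x : Prop :=
  dt (fun tau => kinetic tau x + internal tau x) t
  + div (fun y => (kinetic t y + internal t y + pressure g (w t y)) *: u t y) x
  = div (fun y => - qF t y + app_mx (PiNS t y) (u t y)) x
    + rho (w t x) * dotv (u t x) (f t x) + Q t x.

Record smooth_solution : Prop := SmoothSolution {
  sol_state : forall t x, 0 <= t -> Omega x -> admissible g (w t x);
  sol_coef : forall t x, 0 <= t -> Omega x ->
    [/\ 0 <= mu t x, 0 <= lambda t x & 0 <= kappa t x];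
  sol_heat : forall t x, 0 <= t -> Omega x -> 0 <= Q t x;
  sol_smooth : smooth_fields;
  sol_mass : forall t x, 0 <= t -> Omega x -> mass_balance t x;
  sol_momentum : forall t x, 0 <= t -> Omega x -> momentum_balance t x;
  sol_energy : forall t x, 0 <= t -> Omega x -> energy_balance t x
}.

End BalanceSystem.

(* Main.v *)
Require Import Defs.
From mathcomp Require Import all_boot all_order all_algebra.
From mathcomp Require Import all_classical all_reals all_analysis.
From mathcomp Require Import ring lra.

Set Implicit Arguments.
Unset Strict Implicit.
Unset Printing Implicit Defensive.

Import Order.TTheory GRing.Theory Num.Theory.
Import numFieldNormedType.Exports.
Local Open Scope classical_set_scope.
Local Open Scope ring_scope.

(** Write P_k = p + p_{*k} = R_k r_k theta and K = c_V rho theta.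

    The speed of sound.  The definitions give alpha_k P_k = sigma_k K, hence
    rho (eps - eps_0) + p = gamma K ([enthalpyE]).  Eliminating alpha_1 and
    alpha_2 through alpha_1 + alpha_2 = 1 makes the common pressure a root of
    X^2 = b X + c ([pressure_root]), and in terms of the state
      2 p - b = gamma (alpha_2 P_1 + alpha_1 P_2) - P_1 P_2 / K,
    which is positive ([root_gap_gt0]).  So p is the larger root p_+, and
    sqrt d = 2 p - b.  With sigma_k, gamma and eps_0 held fixed, b and c depend
    on rho and eps only through E = rho (eps - eps_0); implicit differentiation
    of p^2 = b p + c gives
      dp_+/dE = (b' p + c') / sqrt d = P_1 P_2 / (K sqrt d)
    ([is_derive_p_plus]).  The chain rule then multiplies this by
    (eps - eps_0) + p / rho = gamma K / rho, which is the formula for c_s^2.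

    The pressure equation.  Everything is computed with the material derivative
    D = d/dt + u . grad at one point ([is_material]), which obeys the sum and
    product rules and turns d_t h + div (h u) into D h + h div u.  Subtracting
    the momentum balance multiplied by u from the energy balance leaves
      D (rho eps) = S - (rho eps + p) div u,  S = div (-q) + Pi : grad u + Q
    ([internal_energy_equation]).  Mass balance and the two pressure laws give
      D alpha_k = alpha_k (D theta / theta - div u - D p / P_k).
    These two identities, D alpha_1 + D alpha_2 = 0 and the internal energy
    balance form a linear system in D alpha_1, D alpha_2, D theta and D p;
    elimination ([mixture_elimination]) leaves
      K (2 p - b) D p + gamma K P_1 P_2 div u = P_1 P_2 S,
    and 2 p - b = sqrt d together with the formula for c_s^2 turns this into
    the stated equation.  Since rho eps, the pressures and the densities are
    polynomials in alpha_k, r_k, theta on admissible states, no quotient is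
    ever differentiated. *)

(** * Mixture states and the speed of sound *)

Lemma sum_ord2 (V : nmodType) (F : 'I_2 -> V) : \sum_k F k = F c1 + F c2.
Proof.
by rewrite big_ord_recr big_ord1; congr (F _ + F _); apply: val_inj.
Qed.

Lemma ord2_ind (P : 'I_2 -> Prop) : P c1 -> P c2 -> forall k, P k.
Proof.
move=> P1 P2 k; case: (splitP (k : 'I_(1 + 1))) => j kj.
  by have -> : k = c1 by apply: val_inj; rewrite /= kj (ord1 j).
by have -> : k = c2 by apply: val_inj; rewrite /= kj (ord1 j).
Qed.

Lemma R_gas_gt0 (R : realType) (a : stiffened_gas R) : 0 < R_gas a.
Proof. by rewrite mulr_gt0 ?c_V_gt0 // subr_gt0 adiab_gt1. Qed.

Section AdmissibleState.
Variables (R : realType) (g : 'I_2 -> stiffened_gas R) (s : mix_state R).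
Hypothesis adm : admissible g s.

Local Notation p := (pressure g s).
Local Notation q k := (p_star (g k)).

Definition heat : R := cVmix g s * rho s * temp s.

Lemma shifted_pressureE k : p + q k = R_gas (g k) * dens s k * temp s.
Proof.
case: adm => _ _ _ _ [e _].
have -> : p = comp_pressure g s k by elim/ord2_ind: k.
exact: subrK.
Qed.

Lemma shifted_pressure_gt0 k : 0 < p + q k.
Proof.
case: adm => r0 _ t0 _ _.
by rewrite shifted_pressureE 2?mulr_gt0 ?R_gas_gt0.
Qed.

Lemma pdens_gt0 k : 0 < pdens s k.
Proof.
by case: adm => r0 a0 _ _ _; have /andP[a1 _] := a0 k; rewrite mulr_gt0.
Qed.

Lemma rho_gt0 : 0 < rho s.
Proof. by rewrite /rho sum_ord2 addr_gt0 ?pdens_gt0. Qed.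

Lemma cVmix_rhoE : cVmix g s * rho s = \sum_k c_V (g k) * pdens s k.
Proof. by rewrite /cVmix divfK ?gt_eqF ?rho_gt0. Qed.

Lemma cVmix_gt0 : 0 < cVmix g s.
Proof.
rewrite -(pmulr_lgt0 _ rho_gt0) cVmix_rhoE sum_ord2.
by apply: addr_gt0; apply: mulr_gt0 (c_V_gt0 _) (pdens_gt0 _).
Qed.

Lemma heat_gt0 : 0 < heat.
Proof.
case: adm => _ _ t0 _ _; apply: mulr_gt0 t0.
exact: mulr_gt0 cVmix_gt0 rho_gt0.
Qed.

Lemma heat_neq0 : heat != 0. Proof. by rewrite gt_eqF ?heat_gt0. Qed.

(** Multiplying P_k = R_k r_k theta by alpha_k: this replaces sigma_k, which is
    what b and c are made of, by the volume fractions. *)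
Lemma vfrac_shifted_pressure k : vfrac s k * (p + q k) = sigma g s k * heat.
Proof.
have c0 := cVmix_gt0; have r0 := rho_gt0.
rewrite shifted_pressureE /sigma /heat /pdens; field.
by rewrite !gt_eqF.
Qed.

Lemma vfrac_sum : vfrac s c1 + vfrac s c2 = 1.
Proof. by case: adm => _ _ _ <- _; rewrite sum_ord2. Qed.

Lemma gamE : gam g s = sigma g s c1 + sigma g s c2 + 1.
Proof.
have c0 := cVmix_gt0; have r0 := rho_gt0.
rewrite /gam /Rmix sum_ord2 /sigma; field.
by rewrite !gt_eqF.
Qed.

(** rho_k / r_k = alpha_k removes the quotient from the internal energy: on
    admissible states it is a polynomial in the state variables. *)
Lemma internal_energyE :
  rho s * eps g s =
  \sum_k (c_V (g k) * pdens s k * temp s + vfrac s k * q k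
          + eps_0 (g k) * pdens s k).
Proof.
case: adm => d0 _ _ _ _.
rewrite /eps mulrC divfK ?gt_eqF ?rho_gt0 //; apply: eq_bigr => k _.
rewrite /comp_energy /pdens; field.
by rewrite gt_eqF.
Qed.

(** Summing alpha_k P_k = sigma_k K over k turns the terms alpha_k p_{*k} of the
    internal energy into (gamma - 1) K - p. *)
Lemma enthalpyE : rho s * (eps g s - eps0 g s) + p = gam g s * heat.
Proof.
have := internal_energyE; have v1 := vfrac_shifted_pressure c1.
have v2 := vfrac_shifted_pressure c2; have := cVmix_rhoE; have ve := vfrac_sum.
have e0 : rho s * eps0 g s = \sum_k pdens s k * eps_0 (g k).
  by rewrite /eps0 mulrC divfK ?gt_eqF ?rho_gt0.
rewrite gamE mulrBr e0 !mulrDl -v1 -v2 mul1r /heat => -> ->.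
(* p = (alpha_1 + alpha_2) p *)
rewrite !sum_ord2 -[X in _ + X = _]mul1r -ve; ring.
Qed.

(** The difference 2 p - b between p and the other root of X^2 = b X + c,
    expressed so that its sign can be read off. *)
Definition root_gap : R :=
  gam g s * (vfrac s c2 * (p + q c1) + vfrac s c1 * (p + q c2))
  - (p + q c1) * (p + q c2) / heat.

Lemma sigmaE k : sigma g s k = vfrac s k * (p + q k) / heat.
Proof. by rewrite vfrac_shifted_pressure mulfK ?heat_neq0. Qed.

Local Notation B := (b_fun g (sigma g s) (eps0 g s) (rho s) (eps g s)).
Local Notation C := (c_fun g (sigma g s) (gam g s) (eps0 g s) (rho s) (eps g s)).

Lemma energy_gapE : rho s * (eps g s - eps0 g s) = gam g s * heat - p.
Proof. by rewrite -enthalpyE addrK. Qed.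

Lemma pressure_root : p ^+ 2 = B * p + C.
Proof.
have K0 := heat_neq0.
rewrite /b_fun /c_fun sum_ord2 energy_gapE gamE !sigmaE.
have -> : vfrac s c2 = 1 - vfrac s c1 by rewrite -vfrac_sum addrC addKr.
by field.
Qed.

Lemma root_gapE : root_gap = 2 * p - B.
Proof.
have K0 := heat_neq0.
rewrite /root_gap /b_fun sum_ord2 energy_gapE gamE !sigmaE.
have -> : vfrac s c2 = 1 - vfrac s c1 by rewrite -vfrac_sum addrC addKr.
by field.
Qed.

(** Substituting gamma = 1 + (alpha_1 P_1 + alpha_2 P_2) / K makes the negative
    term P_1 P_2 / K part of a square: the remaining terms of order 1 / K sum to
    alpha_1 alpha_2 (P_1 - P_2)^2, where P_1 - P_2 = p_{*1} - p_{*2}. *)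
Lemma root_gap_gt0 : 0 < root_gap.
Proof.
have K0 := heat_gt0; have P1 := shifted_pressure_gt0 c1.
have P2 := shifted_pressure_gt0 c2.
case: adm => _ a01 _ _ _; have /andP[a1 _] := a01 c1; have /andP[a2 _] := a01 c2.
have -> : root_gap = vfrac s c2 * (p + q c1) + vfrac s c1 * (p + q c2)
  + vfrac s c1 * vfrac s c2 * (q c1 - q c2) ^+ 2 / heat.
  rewrite /root_gap gamE !sigmaE.
  have -> : vfrac s c2 = 1 - vfrac s c1 by rewrite -vfrac_sum addrC addKr.
  by field; rewrite gt_eqF.
have X1 := mulr_gt0 a2 P1; have X2 := mulr_gt0 a1 P2.
apply: ltr_wpDr (addr_gt0 X1 X2).
apply: divr_ge0 (ltW K0); apply: mulr_ge0 (sqr_ge0 _).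
by rewrite mulr_ge0 ?ltW.
Qed.

(** For a root p of X^2 = b X + c the discriminant b^2 + 4 c is (2 p - b)^2. *)
Lemma d_mixE : d_mix g s = root_gap ^+ 2.
Proof.
rewrite root_gapE /d_mix /d_fun; have := pressure_root.
move: B C => b c e; rewrite (_ : c = p ^+ 2 - b * p); last by rewrite e; ring.
ring.
Qed.

Lemma sqrt_d_mixE : Num.sqrt (d_mix g s) = root_gap.
Proof. by rewrite d_mixE sqrtr_sqr gtr0_norm // root_gap_gt0. Qed.

Lemma p_plusE : p_plus g s = p.
Proof.
rewrite /p_plus /p_plus_fun -/(d_mix g s) sqrt_d_mixE root_gapE.
by field.
Qed.

End AdmissibleState.

(** Implicit differentiation of p^2 = b p + c: p' (2 p - b) = b' p + c', with
    2 p - b the square root of the discriminant. *)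
Lemma is_derive_quadratic_root (R : realType) (b c : R -> R) (z b' c' : R) :
  is_derive z 1 b b' -> is_derive z 1 c c' -> 0 < b z ^+ 2 + 4 * c z ->
  is_derive z 1 (fun y => 2^-1 * (b y + Num.sqrt (b y ^+ 2 + 4 * c y)))
    ((b' * (2^-1 * (b z + Num.sqrt (b z ^+ 2 + 4 * c z))) + c')
     / Num.sqrt (b z ^+ 2 + 4 * c z)).
Proof.
move=> db dc d0.
pose d : R -> R := b ^+ 2 + cst 4 * c.
have dd : is_derive z 1 d (2 * b z * b' + 4 * c').
  by apply: is_derive_eq; rewrite /GRing.scale /= expr1 mulr0 addr0.
have ds := @is_derive1_comp _ _ d _ _ _ (is_derive1_sqrt d0) dd.
have -> : (fun y => 2^-1 * (b y + Num.sqrt (b y ^+ 2 + 4 * c y)))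
   = cst 2^-1 * (b + (Num.sqrt \o d)).
  by [].
apply: is_derive_eq; rewrite /GRing.scale /=.
have s0 : Num.sqrt (b z ^+ 2 + 4 * c z) != 0 by rewrite gt_eqF ?sqrtr_gt0.
by field.
Qed.

Section SoundSpeed.
Variables (R : realType) (g : 'I_2 -> stiffened_gas R) (s : mix_state R).
Hypothesis adm : admissible g s.

Local Notation dp_dE :=
  ((pressure g s + p_star (g c1)) * (pressure g s + p_star (g c2))
   / (heat g s * Num.sqrt (d_mix g s))).

(** With the mixture parameters frozen, p_+ depends on density and energy only
    through E = r (e - eps_0), so both partial derivatives of p_+ are derivatives
    along a curve (r, e) through the state. *)
Lemma is_derive_p_plus (z m : R) (r e : R -> R) :
  r z = rho s -> e z = eps g s ->
  is_derive z 1 (fun y => r y * (e y - eps0 g s)) m ->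
  is_derive z 1
    (fun y => p_plus_fun g (sigma g s) (gam g s) (eps0 g s) (r y) (e y))
    (m * dp_dE).
Proof.
set E := (fun y => r y * _) => rz ez dE.
have hE y : r y * (e y - eps0 g s) = E y by [].
set b := fun y => b_fun g (sigma g s) (eps0 g s) (r y) (e y).
set c := fun y => c_fun g (sigma g s) (gam g s) (eps0 g s) (r y) (e y).
have db : is_derive z 1 b ((sigma g s c1 + sigma g s c2) * m).
  (* b is affine in E; its value at E = 0 is the constant term *)
  have -> : b = (sigma g s c1 + sigma g s c2) *: E
      + cst (b_fun g (sigma g s) 0 0 0).
    apply/funext => y; rewrite /b /b_fun !sum_ord2 /= !hE.
    by rewrite !fctE /GRing.scale /=; ring.
  by apply: is_derive_eq; rewrite ?subr0 ?addr0.
have dc : is_derive z 1 c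
    ((sigma g s c1 * p_star (g c2) + sigma g s c2 * p_star (g c1)) * m).
  have -> : c = (sigma g s c1 * p_star (g c2) + sigma g s c2 * p_star (g c1)) *: E
      + cst (- (gam g s * p_star (g c1) * p_star (g c2))).
    by apply/funext => y; rewrite /c /c_fun /= !hE.
  by apply: is_derive_eq; rewrite ?subr0 ?addr0.
have dz : b z ^+ 2 + 4 * c z = d_mix g s by rewrite /b /c rz ez.
have bz : 2^-1 * (b z + Num.sqrt (d_mix g s)) = pressure g s.
  by rewrite -[RHS]p_plusE // /b rz ez.
have d0 : 0 < b z ^+ 2 + 4 * c z by rewrite dz d_mixE // exprn_gt0 ?root_gap_gt0.
have := is_derive_quadratic_root db dc d0; rewrite dz bz.
move=> H; apply: is_derive_eq H _.
have s0 : Num.sqrt (d_mix g s) != 0 by rewrite gt_eqF ?sqrtr_gt0 -?dz.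
have K0 := heat_neq0 adm; rewrite !sigmaE //.
have -> : vfrac s c2 = 1 - vfrac s c1 by rewrite -(vfrac_sum adm) addrC addKr.
by field; rewrite s0 K0.
Qed.

Lemma is_derive_p_plus_rho :
  is_derive (rho s) 1 (p_plus_of_rho g s) ((eps g s - eps0 g s) * dp_dE).
Proof.
apply: (is_derive_p_plus (r := id) (e := cst (eps g s))) => //.
have -> : (fun y : R => y * (eps g s - eps0 g s)) = (eps g s - eps0 g s) *: id.
  by apply/funext => y; rewrite !fctE /GRing.scale /= mulrC.
by apply: is_derive_eq; rewrite /GRing.scale /= mulr1.
Qed.

Lemma is_derive_p_plus_eps :
  is_derive (eps g s) 1 (p_plus_of_eps g s) (rho s * dp_dE).
Proof.
apply: (is_derive_p_plus (r := cst (rho s)) (e := id)) => //.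
have -> : (fun y : R => rho s * (y - eps0 g s)) = rho s *: (id - cst (eps0 g s)) by [].
by apply: is_derive_eq; rewrite /GRing.scale /= subr0 mulr1.
Qed.

Lemma cs2E :
  cs2 g s = gam g s * (p_plus g s + p_star (g c1)) * (p_plus g s + p_star (g c2))
            / (rho s * Num.sqrt (d_mix g s)).
Proof.
rewrite /cs2 !derive1E.
rewrite (@derive_val _ _ _ _ _ _ _ is_derive_p_plus_rho).
rewrite (@derive_val _ _ _ _ _ _ _ is_derive_p_plus_eps) p_plusE //.
have s0 : Num.sqrt (d_mix g s) != 0 by rewrite sqrt_d_mixE // gt_eqF ?root_gap_gt0.
have r0 : rho s != 0 by rewrite gt_eqF ?(rho_gt0 adm).
have K0 := heat_neq0 adm.
have -> : gam g s = (rho s * (eps g s - eps0 g s) + pressure g s) / heat g s.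
  by rewrite enthalpyE // mulfK.
by field; rewrite r0 s0 K0.
Qed.

Lemma gam_gt0 : 0 < gam g s.
Proof.
rewrite gamE // !sigmaE //; case: adm => _ a01 _ _ _.
have /andP[a1 _] := a01 c1; have /andP[a2 _] := a01 c2.
by rewrite !addr_gt0 // divr_gt0 ?heat_gt0 ?mulr_gt0 ?shifted_pressure_gt0.
Qed.

Lemma cs2_gt0 : 0 < cs2 g s.
Proof.
rewrite cs2E p_plusE // sqrt_d_mixE //.
by rewrite divr_gt0 ?mulr_gt0 ?gam_gt0 ?shifted_pressure_gt0 ?(rho_gt0 adm)
  ?root_gap_gt0.
Qed.

End SoundSpeed.

(** * Calculus of the material derivative *)

Section TimeDerivative.
Variable R : realType.
Implicit Types (h k : R -> R) (t l m : R).

Local Notation admissible_steps t := (within [set tau : R | 0 <= t + tau] 0^').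

(** Both one-sided (t = 0) and two-sided (t > 0) steps contain all small positive
    ones, so limits of time difference quotients are unique. *)
Lemma admissible_steps_proper t : 0 <= t -> ProperFilter (admissible_steps t).
Proof.
move=> t0; apply: Build_ProperFilter_ex => P FP.
case: FP => e /= e0 Pe; exists (e / 2); apply: Pe => /=.
- by rewrite sub0r normrN gtr0_norm; lra.
- by rewrite gt_eqF //; lra.
- lra.
Qed.

Lemma dt_quot_lim h t l : 0 <= t -> dt_quot h t --> l ->
  dt_derivable h t /\ dt h t = l.
Proof.
move=> t0 hl; have PF := admissible_steps_proper t0.
by split; [apply/cvg_ex; exists l | apply: cvg_lim].
Qed.

Lemma dt_cst (a : R) t : dt_quot (fun=> a) t --> 0.
Proof.
rewrite /dt_quot; have -> : (fun tau : R => tau^-1 * (a - a)) = cst 0.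
  by apply/funext => y; rewrite subrr mulr0.
exact: cvg_cst.
Qed.

Lemma dt_quotD h k t l m : dt_quot h t --> l -> dt_quot k t --> m ->
  dt_quot (fun tau => h tau + k tau) t --> l + m.
Proof.
move=> hl km; rewrite /dt_quot.
have -> : (fun tau => tau^-1 * (h (t + tau) + k (t + tau) - (h t + k t)))
   = (fun tau => tau^-1 * (h (t + tau) - h t) + tau^-1 * (k (t + tau) - k t)).
  by apply/funext => y; ring.
exact: cvgD hl km.
Qed.

Lemma dtD h k t : 0 <= t -> dt_derivable h t -> dt_derivable k t ->
  dt (fun tau => h tau + k tau) t = dt h t + dt k t.
Proof. by move=> t0 dh dk; case: (dt_quot_lim t0 (dt_quotD dh dk)). Qed.

Lemma dt_quot_continuous h t l : dt_quot h t --> l ->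
  h (t + tau) @[tau --> admissible_steps t] --> h t.
Proof.
move=> hl.
have id0 : (id : R -> R) @ admissible_steps t --> 0.
  apply: cvg_within_filter; exact: nbhs_dnbhs.
have : (fun tau => h t + tau * (tau^-1 * (h (t + tau) - h t)))
     @ admissible_steps t --> h t + 0 * l.
  by apply: cvgD; [exact: cvg_cst | apply: cvgM].
rewrite mul0r addr0; apply: cvg_trans; apply: near_eq_cvg.
apply: (@cvg_within _ 0^') ; apply: filterS (nbhs_dnbhs_neq 0) => tau tau0.
by rewrite mulVKf // addrC subrK.
Qed.

Lemma dt_quotM h k t l m : dt_quot h t --> l -> dt_quot k t --> m ->
  dt_quot (fun tau => h tau * k tau) t --> l * k t + h t * m.
Proof.
move=> hl km; rewrite /dt_quot.
have -> : (fun tau => tau^-1 * (h (t + tau) * k (t + tau) - h t * k t))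
   = (fun tau => tau^-1 * (h (t + tau) - h t) * k (t + tau)
                 + h t * (tau^-1 * (k (t + tau) - k t))).
  by apply/funext => y; ring.
apply: cvgD; first by apply: cvgM hl (dt_quot_continuous km).
by apply: cvgM km; exact: cvg_cst.
Qed.

Lemma eq_dt_quot h k t l : 0 <= t -> (forall tau, 0 <= tau -> h tau = k tau) ->
  dt_quot h t --> l -> dt_quot k t --> l.
Proof.
move=> t0 hk; apply: cvg_trans; apply: near_eq_cvg.
apply: filterS (withinT _ _) => tau /= ttau.
by rewrite !hk.
Qed.

End TimeDerivative.

Section MaterialDerivative.
Variables (R : realType) (n : nat) (Omega : set 'rV[R]_n).
Variables (t : R) (x v : 'rV[R]_n).
Hypotheses (t0 : 0 <= t) (oOmega : open Omega) (Ox : Omega x).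
Implicit Types (h k : R -> 'rV[R]_n -> R) (m l : R).

Definition material h : R := dt (h^~ x) t + dotv v (grad (h t) x).

(** As for a derivative, existence and value are kept together, so that one
    computation yields both the smoothness and the equation. *)
Definition is_material h m : Prop :=
  [/\ dt_derivable (h^~ x) t, partial_derivable (h t) x & material h = m].

Lemma is_material_cst (a : R) : is_material (fun _ _ => a) 0.
Proof.
have [dd de] := dt_quot_lim t0 (dt_cst a t).
split; [exact: dd | by move=> i; exact: derivable_cst | ].
rewrite /material de add0r /dotv big1 // => i _.
by rewrite mxE derive_cst mulr0.
Qed.

Lemma is_materialD h k m l : is_material h m -> is_material k l ->
  is_material (fun tau y => h tau y + k tau y) (m + l).
Proof.
move=> [th ph <-] [tk pk <-].
have [dd de] := dt_quot_lim t0 (dt_quotD th tk).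
split; [exact: dd | by move=> i; apply: derivableD | ].
rewrite /material de addrACA -/(dt _ t); congr (_ + _ + _).
rewrite -big_split; apply: eq_bigr => i _ /=.
by rewrite !mxE -mulrDr deriveD.
Qed.

Lemma is_materialM h k m l : is_material h m -> is_material k l ->
  is_material (fun tau y => h tau y * k tau y) (m * k t x + h t x * l).
Proof.
move=> [th ph <-] [tk pk <-].
have [dd de] := dt_quot_lim t0 (dt_quotM th tk).
split; [exact: dd | by move=> i; apply: derivableM | ].
rewrite /material de mulrDl mulrDr addrACA; congr (_ + _).
rewrite mulr_suml mulr_sumr -big_split; apply: eq_bigr => i _ /=.
by rewrite !mxE deriveM // /GRing.scale /=; ring.
Qed.

(** Only values at nonnegative times inside the open set count, so identities
    valid on admissible states, such as the equality of the two component
    pressures, may be differentiated. *)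
Lemma eq_is_material h k m :
  (forall tau y, 0 <= tau -> Omega y -> h tau y = k tau y) ->
  is_material h m -> is_material k m.
Proof.
move=> hk [th ph <-].
have nhk : \near x, h t x = k t x.
  by apply: filterS (open_nbhs_nbhs (conj oOmega Ox)) => y Oy; rewrite hk.
have [dd de] := dt_quot_lim t0
  (eq_dt_quot t0 (fun tau tau0 => hk tau x tau0 Ox) th).
split; [exact: dd | by move=> i; apply: near_eq_derivable (ph i) | ].
rewrite /material de; congr (_ + _); apply: eq_bigr => i _.
by rewrite !mxE; congr (_ * _); apply/esym/near_eq_derive.
Qed.

Lemma is_material_sum (J : Type) (r : seq J) (h : J -> R -> 'rV[R]_n -> R)
    (m : J -> R) : (forall j, is_material (h j) (m j)) ->
  is_material (fun tau y => \sum_(j <- r) h j tau y) (\sum_(j <- r) m j).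
Proof.
move=> hm; elim: r => [|j r IH].
  rewrite big_nil; apply: (eq_is_material _ (is_material_cst 0)) => tau y _ _.
  by rewrite big_nil.
rewrite big_cons; apply: (eq_is_material _ (is_materialD (hm j) IH)) => tau y _ _.
by rewrite big_cons.
Qed.

Lemma is_material_unique h m l : is_material h m -> is_material h l -> m = l.
Proof. by move=> [_ _ <-] [_ _ <-]. Qed.

End MaterialDerivative.

Section Divergence.
Variables (R : realType) (n : nat) (x : 'rV[R]_n).

Lemma divD (v1 v2 : 'rV[R]_n -> 'rV[R]_n) :
  (forall j, partial_derivable (fun y => v1 y 0 j) x) ->
  (forall j, partial_derivable (fun y => v2 y 0 j) x) ->
  div (fun y => v1 y + v2 y) x = div v1 x + div v2 x.
Proof.
move=> d1 d2; rewrite /div -big_split; apply: eq_bigr => i _ /=.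
rewrite -(deriveD (d1 i i) (d2 i i)); congr ('D_('e_i) _ x).
by apply/funext => y; rewrite mxE.
Qed.

Lemma divZ (phi : 'rV[R]_n -> R) (v : 'rV[R]_n -> 'rV[R]_n) :
  partial_derivable phi x -> (forall j, partial_derivable (fun y => v y 0 j) x) ->
  div (fun y => phi y *: v y) x = dotv (v x) (grad phi x) + phi x * div v x.
Proof.
move=> dphi dv; rewrite /div /dotv mulr_sumr -big_split; apply: eq_bigr => i _ /=.
have -> : (fun y => (phi y *: v y) 0 i) = phi * (fun y => v y 0 i).
  by apply/funext => y; rewrite mxE.
by rewrite (deriveM (dphi i) (dv i i)) mxE addrC.
Qed.

Lemma app_mx_coordE (A : 'rV[R]_n -> 'M[R]_n) (v : 'rV[R]_n -> 'rV[R]_n) i :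
  (fun y => app_mx (A y) (v y) 0 i)
  = \sum_j (fun y => v y 0 j) * (fun y => A y i j).
Proof.
apply/funext => y; rewrite mxE fct_sumE; apply: eq_bigr => j _.
by rewrite mxE.
Qed.

Lemma partial_derivable_app_mx (A : 'rV[R]_n -> 'M[R]_n)
    (v : 'rV[R]_n -> 'rV[R]_n) :
  (forall i j, partial_derivable (fun y => A y i j) x) ->
  (forall j, partial_derivable (fun y => v y 0 j) x) ->
  forall i, partial_derivable (fun y => app_mx (A y) (v y) 0 i) x.
Proof.
move=> dA dv i k; rewrite app_mx_coordE.
by apply: derivable_sum => j; apply: derivableM; [exact: dv | exact: dA].
Qed.

(** The tensor acts through its second index while both divergences contract the
    first one; the two conventions match without symmetry of the tensor. *)
Lemma div_app_mx (A : 'rV[R]_n -> 'M[R]_n) (v : 'rV[R]_n -> 'rV[R]_n) :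
  (forall i j, partial_derivable (fun y => A y i j) x) ->
  (forall j, partial_derivable (fun y => v y 0 j) x) ->
  div (fun y => app_mx (A y) (v y)) x
  = ddot (A x) (vgrad v x) + dotv (v x) (tdiv A x).
Proof.
move=> dA dv.
have -> : dotv (v x) (tdiv A x)
    = \sum_i \sum_j v x 0 j * 'D_('e_i) (fun y => A y i j) x.
  rewrite exchange_big; apply: eq_bigr => j _ /=.
  by rewrite mxE mulr_sumr.
rewrite /div /ddot -big_split; apply: eq_bigr => i _ /=.
rewrite app_mx_coordE derive_sum => [|j]; last by apply: derivableM; [exact: dv | exact: dA].
rewrite -big_split; apply: eq_bigr => j _ /=.
by rewrite (deriveM (dv j i) (dA i j i)) mxE addrC.
Qed.

End Divergence.

Section ConservationForm.
Variables (R : realType) (n : nat) (t : R) (x : 'rV[R]_n).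
Variable u : R -> 'rV[R]_n -> 'rV[R]_n.
Hypothesis du : forall j, partial_derivable (fun y => u t y 0 j) x.

Lemma conservation_form (h : R -> 'rV[R]_n -> R) (m : R) :
  is_material t x (u t x) h m ->
  dt (h^~ x) t + div (fun y => h t y *: u t y) x = m + h t x * div (u t) x.
Proof. by move=> [_ dh <-]; rewrite divZ // addrA. Qed.

End ConservationForm.

(** * Balance of pressure *)

(** The linear system satisfied by the material derivatives of the volume
    fractions (a1', a2'), of the pressure (p') and of the logarithm of the
    temperature (T); delta is the divergence of the velocity, S the energy source.
    The equations for ai' Pi + ai p' give ai' = ai (T - delta - p' / Pi); since
    a1' + a2' = 0, their sum determines T, and the last hypothesis then involves p' alone. *)
Lemma mixture_elimination (F : fieldType)
    (a1 a2 P1 P2 p q1 q2 K gamma a1' a2' p' T delta S : F) :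
  K != 0 -> P1 != 0 -> P2 != 0 ->
  a1 + a2 = 1 -> p + q1 = P1 -> p + q2 = P2 ->
  gamma * K = K + (a1 * P1 + a2 * P2) ->
  a1' + a2' = 0 ->
  a1' * P1 + a1 * p' = a1 * P1 * (T - delta) ->
  a2' * P2 + a2 * p' = a2 * P2 * (T - delta) ->
  K * T + (a1' * q1 + a2' * q2) = S - (p + (a1 * q1 + a2 * q2)) * delta ->
  K * (gamma * (a2 * P1 + a1 * P2) - P1 * P2 / K) * p' + gamma * K * P1 * P2 * delta
  = P1 * P2 * S.
Proof.
move=> K0 P10 P20 asum q1E q2E gE a'sum e1 e2 eS.
have a1E : a1' = a1 * (T - delta - p' / P1).
  by apply: (mulIf P10); rewrite -[LHS](addrK (a1 * p')) e1; field.
have a2E : a2' = a2 * (T - delta - p' / P2).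
  by apply: (mulIf P20); rewrite -[LHS](addrK (a2 * p')) e2; field.
have TE : T = delta + p' * (a1 / P1 + a2 / P2).
  have : (a1 + a2) * (T - delta) = p' * (a1 / P1 + a2 / P2) + (a1' + a2').
    by rewrite a1E a2E; field; rewrite P10 P20.
  by rewrite asum a'sum mul1r addr0 => <-; rewrite addrC subrK.
have gammaE : gamma = 1 + (a1 * P1 + a2 * P2) / K.
  by apply: (mulIf K0); rewrite gE; field.
have -> : S = K * T + (a1' * q1 + a2' * q2) + (p + (a1 * q1 + a2 * q2)) * delta.
  by rewrite eS subrK.
have -> : q1 = P1 - p by rewrite -q1E addrC addKr.
have -> : q2 = P2 - p by rewrite -q2E addrC addKr.
rewrite a1E a2E TE gammaE.
have -> : a2 = 1 - a1 by rewrite -asum addrC addKr.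
by field; rewrite K0 P10 P20.
Qed.

Section Solution.
Variables (R : realType) (g : 'I_2 -> stiffened_gas R).
Variables (n : nat) (Omega : set 'rV[R]_n).
Variables (w : R -> 'rV[R]_n -> mix_state R) (u : R -> 'rV[R]_n -> 'rV[R]_n).
Variables (mu lambda kappa : R -> 'rV[R]_n -> R).
Variables (f : R -> 'rV[R]_n -> 'rV[R]_n) (Q : R -> 'rV[R]_n -> R).
Hypothesis oOmega : open Omega.
Hypothesis sol : smooth_solution g Omega w u mu lambda kappa f Q.
Variables (t : R) (x : 'rV[R]_n).
Hypotheses (t0 : 0 <= t) (Ox : Omega x).

Local Notation is_mat := (is_material t x (u t x)).
Local Notation D := (material t x (u t x)).
Local Notation delta := (div (u t) x).
Local Notation p := (fun tau y => pressure g (w tau y)).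
Local Notation energy_source :=
  (div (fun y => - qF w kappa t y) x
   + ddot (PiNS u mu lambda t x) (vgrad (u t) x) + Q t x).

Lemma state_admissible : admissible g (w t x).
Proof. exact (sol_state sol t0 Ox). Qed.

Lemma smooth1_is_material h : smooth1 Omega h -> is_mat h (D h).
Proof. by move=> /(_ t x t0 Ox) []. Qed.

Lemma velocity_derivable j : partial_derivable (fun y => u t y 0 j) x.
Proof. exact: (smooth_velocity (sol_smooth sol) j t0 Ox).2. Qed.

Lemma is_material_velocity j :
  is_mat (fun tau y => u tau y 0 j) (D (fun tau y => u tau y 0 j)).
Proof. exact: smooth1_is_material (smooth_velocity (sol_smooth sol) j). Qed.

Lemma is_material_temp :
  is_mat (fun tau y => temp (w tau y)) (D (fun tau y => temp (w tau y))).
Proof. exact: smooth1_is_material (smooth_temp (sol_smooth sol)). Qed.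

Lemma is_material_vfrac k :
  is_mat (fun tau y => vfrac (w tau y) k) (D (fun tau y => vfrac (w tau y) k)).
Proof. exact: smooth1_is_material (smooth_vfrac (sol_smooth sol) k). Qed.

Lemma is_material_dens k :
  is_mat (fun tau y => dens (w tau y) k) (D (fun tau y => dens (w tau y) k)).
Proof. exact: smooth1_is_material (smooth_dens (sol_smooth sol) k). Qed.

Lemma is_material_comp_pressure k :
  is_mat (fun tau y => comp_pressure g (w tau y) k)
    (R_gas (g k) * (D (fun tau y => dens (w tau y) k) * temp (w t x)
       + dens (w t x) k * D (fun tau y => temp (w tau y)))).
Proof.
have := is_materialD t0 (is_materialM t0 (is_materialM t0
  (is_material_cst x (u t x) t0 (R_gas (g k))) (is_material_dens k)) is_material_temp)
  (is_material_cst x (u t x) t0 (- p_star (g k))).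
by congr is_material; ring.
Qed.

(** The common pressure obeys the law of either component; both forms are needed
    for the two equations on the volume fractions. *)
Lemma is_material_pressure k :
  is_mat p (R_gas (g k) * (D (fun tau y => dens (w tau y) k) * temp (w t x)
       + dens (w t x) k * D (fun tau y => temp (w tau y)))).
Proof.
apply: (eq_is_material t0 oOmega Ox _ (is_material_comp_pressure k)).
move=> tau y tau0 Oy; case: (sol_state sol tau0 Oy) => _ _ _ _ [e _].
by elim/ord2_ind: k.
Qed.

Lemma is_material_pdens k :
  is_mat (fun tau y => pdens (w tau y) k) (- (pdens (w t x) k * delta)).
Proof.
have H := is_materialM t0 (is_material_vfrac k) (is_material_dens k).
have := sol_mass sol t0 Ox k.
rewrite (conservation_form velocity_derivable H) => /eqP; rewrite addr_eq0 => /eqP E.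
by rewrite E in H.
Qed.

Lemma is_material_rho :
  is_mat (fun tau y => rho (w tau y)) (- (rho (w t x) * delta)).
Proof.
rewrite /rho mulr_suml -sumrN.
by apply: (is_material_sum t0 oOmega Ox) => k; exact: is_material_pdens.
Qed.

(** The momentum balance minus the mass balance times u_j. *)
Lemma velocity_equation j :
  rho (w t x) * D (fun tau y => u tau y 0 j) =
  tdiv (PiNS u mu lambda t) x 0 j + rho (w t x) * f t x 0 j
  - grad (p t) x 0 j.
Proof.
have H := is_materialM t0 is_material_rho (is_material_velocity j).
have := congr1 (fun M : 'rV[R]_n => M 0 j) (sol_momentum sol t0 Ox).
rewrite !mxE.
have -> : dt (fun tau => (rho (w tau x) *: u tau x) 0 j) t
   = dt (fun tau => rho (w tau x) * u tau x 0 j) t.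
  by congr (dt _ t); apply/funext => tau; rewrite mxE.
have -> : \sum_i 'D_('e_i) (fun y => (rho (w t y) *: tensor (u t y) (u t y)) i j) x
  = div (fun y => (rho (w t y) * u t y 0 j) *: u t y) x.
  apply: eq_bigr => i _; congr ('D_('e_i) _ x); apply/funext => y.
  by rewrite !mxE; ring.
by rewrite (conservation_form velocity_derivable H) => <-; ring.
Qed.

Lemma is_material_kinetic :
  is_mat (kinetic w u)
    (\sum_j u t x 0 j * (rho (w t x) * D (fun tau y => u tau y 0 j))
     - kinetic w u t x * delta).
Proof.
have usq : is_mat (fun tau y => dotv (u tau y) (u tau y))
    (\sum_j (D (fun tau y => u tau y 0 j) * u t x 0 j
             + u t x 0 j * D (fun tau y => u tau y 0 j))).
  apply: (is_material_sum t0 oOmega Ox _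
    (h := fun j tau y => u tau y 0 j * u tau y 0 j)) => j.
  by have := is_materialM t0 (is_material_velocity j) (is_material_velocity j).
have := is_materialM t0 (is_materialM t0
  (is_material_cst x (u t x) t0 2^-1) is_material_rho) usq.
rewrite [X in _ + X](_ : _ =
    \sum_j u t x 0 j * (rho (w t x) * D (fun tau y => u tau y 0 j))).
  by congr is_material; rewrite /kinetic; ring.
by rewrite mulr_sumr; apply: eq_bigr => j _; field.
Qed.

Lemma is_material_internal :
  is_mat (internal g w)
    (\sum_k (c_V (g k) * (pdens (w t x) k * D (fun tau y => temp (w tau y))
                - pdens (w t x) k * delta * temp (w t x))
      + D (fun tau y => vfrac (w tau y) k) * p_star (g k)
      - eps_0 (g k) * pdens (w t x) k * delta)).
Proof.
pose cst_mat a := is_material_cst x (u t x) t0 a.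
pose h k tau y := c_V (g k) * (pdens (w tau y) k * temp (w tau y))
  + vfrac (w tau y) k * p_star (g k) + eps_0 (g k) * pdens (w tau y) k.
apply: (@eq_is_material _ _ Omega _ _ _ t0 oOmega Ox (fun tau y => \sum_k h k tau y)).
  move=> tau y tau0 Oy; rewrite /internal internal_energyE; last first.
    exact: (sol_state sol).
  by apply: eq_bigr => k _; rewrite /h mulrA.
apply: (is_material_sum t0 oOmega Ox _ (h := h)) => k.
have := is_materialD t0 (is_materialD t0
  (is_materialM t0 (cst_mat (c_V (g k)))
     (is_materialM t0 (is_material_pdens k) is_material_temp))
  (is_materialM t0 (is_material_vfrac k) (cst_mat (p_star (g k)))))
  (is_materialM t0 (cst_mat (eps_0 (g k))) (is_material_pdens k)).
by congr is_material; ring.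
Qed.

(** The energy balance minus the momentum balance contracted with u: the kinetic
    energy, the body force, the work of grad p and u . div Pi cancel, leaving the
    work p div u and the dissipation Pi : grad u. *)
Lemma internal_energy_equation :
  D (internal g w) = energy_source - (internal g w t x + p t x) * delta.
Proof.
have [ti pi _] := is_material_internal.
have I : is_mat (internal g w) (D (internal g w)) by [].
have [tp pp _] := is_material_pressure c1.
have P : is_mat p (D p) by [].
have KI := is_materialD t0 is_material_kinetic I.
have := conservation_form velocity_derivable (is_materialD t0 KI P).
have [tki _ _] := KI.
rewrite (dtD t0 tki tp) => cons.
have := sol_energy sol t0 Ox; rewrite /energy_balance.
have dPi := smooth_PiNS (sol_smooth sol) t0 Ox.
have dq := smooth_qF (sol_smooth sol) t0 Ox.
rewrite divD; first last.
- exact: partial_derivable_app_mx dPi velocity_derivable.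
- move=> j i; have -> : (fun y => (- qF w kappa t y) 0 j)
      = - (fun y => qF w kappa t y 0 j).
    by apply/funext => y; rewrite mxE.
  exact: derivableN (dq j i).
rewrite (div_app_mx dPi velocity_derivable) => E.
have V : \sum_j u t x 0 j * (rho (w t x) * D (fun tau y => u tau y 0 j))
  = dotv (u t x) (tdiv (PiNS u mu lambda t) x)
    + rho (w t x) * dotv (u t x) (f t x) - dotv (u t x) (grad (p t) x).
  rewrite /dotv mulr_sumr -big_split -sumrB; apply: eq_bigr => j _ /=.
  by rewrite velocity_equation; ring.
have Dp : D p = dt (p^~ x) t + dotv (u t x) (grad (p t) x) by [].
rewrite V Dp in cons.
set e' := dt (fun tau => kinetic w u tau x + internal g w tau x) t in cons E.
set F := div (fun y => (kinetic w u t y + internal g w t y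
                        + pressure g (w t y)) *: u t y) x in cons E.
suff : D (internal g w) = (e' + F)
   - (dotv (u t x) (tdiv (PiNS u mu lambda t) x) + rho (w t x) * dotv (u t x) (f t x)
     + (internal g w t x + p t x) * delta).
  by move=> ->; rewrite E; ring.
(* the flux of p brings in a time derivative of p, which cancels *)
transitivity (e' + dt (p^~ x) t + F - dt (p^~ x) t
   - (dotv (u t x) (tdiv (PiNS u mu lambda t) x) + rho (w t x) * dotv (u t x) (f t x)
     + (internal g w t x + p t x) * delta)); last by ring.
by rewrite cons; ring.
Qed.

Lemma pressure_equation :
  D p + rho (w t x) * cs2 g (w t x) * delta
  = cs2 g (w t x) / (gam g (w t x) * cVmix g (w t x) * temp (w t x))
    * energy_source.
Proof.
have adm := state_admissible; set s := w t x in adm *.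
have aE : D (fun tau y => vfrac (w tau y) c1)
    + D (fun tau y => vfrac (w tau y) c2) = 0.
  apply: is_material_unique
    (is_materialD t0 (is_material_vfrac c1) (is_material_vfrac c2)) _.
  apply: (eq_is_material t0 oOmega Ox _ (is_material_cst x (u t x) t0 1)).
  by move=> tau y tau0 Oy; rewrite (vfrac_sum (sol_state sol tau0 Oy)).
have pE k : D p = R_gas (g k) * (D (fun tau y => dens (w tau y) k) * temp s
       + dens s k * D (fun tau y => temp (w tau y))).
  by have [_ _] := is_material_pressure k.
have dE k : D (fun tau y => vfrac (w tau y) k) * dens s k
    + vfrac s k * D (fun tau y => dens (w tau y) k) = - (pdens s k * delta).
  apply: is_material_unique (is_material_pdens k).
  by have := is_materialM t0 (is_material_vfrac k) (is_material_dens k).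
have th0 : temp s != 0 by case: adm => _ _ th0 _ _; rewrite gt_eqF.
set T := D (fun tau y => temp (w tau y)) / temp s.
have e k : D (fun tau y => vfrac (w tau y) k) * (pressure g s + p_star (g k))
    + vfrac s k * D p
    = vfrac s k * (pressure g s + p_star (g k)) * (T - delta).
  rewrite shifted_pressureE // (pE k) /T.
  transitivity (R_gas (g k) * temp s * (- (pdens s k * delta))
    + vfrac s k * R_gas (g k) * dens s k * D (fun tau y => temp (w tau y))).
    by rewrite -dE; ring.
  by rewrite /pdens; field.
have P0 k : pressure g s + p_star (g k) != 0.
  by rewrite gt_eqF ?shifted_pressure_gt0.
have K0 := heat_neq0 adm.
have gK : gam g s * heat g s = heat g s
    + (vfrac s c1 * (pressure g s + p_star (g c1))
       + vfrac s c2 * (pressure g s + p_star (g c2))).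
  by rewrite gamE // !vfrac_shifted_pressure //; ring.
have IE : heat g s * T + (D (fun tau y => vfrac (w tau y) c1) * p_star (g c1)
      + D (fun tau y => vfrac (w tau y) c2) * p_star (g c2))
  = energy_source - (pressure g s + (vfrac s c1 * p_star (g c1)
                      + vfrac s c2 * p_star (g c2))) * delta.
  have [_ _] := is_material_internal; rewrite internal_energy_equation.
  rewrite /internal internal_energyE // /heat cVmix_rhoE // !sum_ord2 => I.
  (* both equations state that the same expression vanishes, up to sign *)
  apply/eqP; rewrite -subr_eq0; move/eqP: I; rewrite -subr_eq0 => /eqP I.
  apply/eqP; rewrite -[RHS]oppr0 -[in RHS]I /T -/s; field.
  exact: th0.
have := mixture_elimination K0 (P0 c1) (P0 c2) (vfrac_sum adm) erefl erefl gK aE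
  (e c1) (e c2) IE.
have S0 : root_gap g s != 0 by rewrite gt_eqF ?root_gap_gt0.
have c0 : cVmix g s != 0 by rewrite gt_eqF ?cVmix_gt0.
have g0 : gam g s != 0 by rewrite gt_eqF ?gam_gt0.
have r0 : rho s != 0 by rewrite gt_eqF ?(rho_gt0 adm).
rewrite cs2E // p_plusE // sqrt_d_mixE // -/(root_gap g s) => main.
have KE : heat g s = cVmix g s * rho s * temp s by [].
set P1 := pressure g s + p_star (g c1) in main *.
set P2 := pressure g s + p_star (g c2) in main *.
have -> : D p = P1 * P2 * energy_source / (heat g s * root_gap g s)
     - gam g s * heat g s * P1 * P2 * delta / (heat g s * root_gap g s).
  by rewrite -main; field; rewrite K0 S0.
rewrite KE; field.
by rewrite g0 c0 th0 r0 S0.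
Qed.

Lemma is_material_p_plus : is_mat (fun tau y => p_plus g (w tau y)) (D p).
Proof.
have [tp pp _] := is_material_pressure c1.
apply: (@eq_is_material _ _ Omega _ _ _ t0 oOmega Ox p) => [tau y tau0 Oy|].
  by rewrite p_plusE //; exact: (sol_state sol).
by split.
Qed.

End Solution.

Theorem proposition3 (R : realType) (g : 'I_2 -> stiffened_gas R) :
  (forall s : mix_state R, admissible g s ->
     [/\ derivable (p_plus_of_rho g s) (rho s) 1,
         derivable (p_plus_of_eps g s) (eps g s) 1,
         cs2 g s = gam g s * (p_plus g s + p_star (g c1))
                           * (p_plus g s + p_star (g c2))
                   / (rho s * Num.sqrt (d_mix g s))
       & 0 < cs2 g s])
  /\
  (forall (n : nat) (Omega : set 'rV[R]_n)
          (w : R -> 'rV[R]_n -> mix_state R) (u : R -> 'rV[R]_n -> 'rV[R]_n)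
          (mu lambda kappa : R -> 'rV[R]_n -> R)
          (f : R -> 'rV[R]_n -> 'rV[R]_n) (Q : R -> 'rV[R]_n -> R),
     (1 <= n <= 3)%N -> open Omega ->
     smooth_solution g Omega w u mu lambda kappa f Q ->
     smooth1 Omega (fun t x => p_plus g (w t x)) /\
     forall (t : R) (x : 'rV[R]_n), 0 <= t -> Omega x ->
       dt (fun tau => p_plus g (w tau x)) t
       + dotv (u t x) (grad (fun y => p_plus g (w t y)) x)
       + rho (w t x) * cs2 g (w t x) * div (u t) x
       = cs2 g (w t x) / (gam g (w t x) * cVmix g (w t x) * temp (w t x))
         * (div (fun y => - qF w kappa t y) x
            + ddot (PiNS u mu lambda t x) (vgrad (u t) x) + Q t x)).
Proof.
split=> [s adm|n Omega w u mu lambda kappa f Q _ oOmega sol].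
  split.
  - by have [] := is_derive_p_plus_rho adm.
  - by have [] := is_derive_p_plus_eps adm.
  - exact: cs2E.
  - exact: cs2_gt0.
split=> [t x t0 Ox|t x t0 Ox].
  by have [] := is_material_p_plus oOmega sol t0 Ox.
have [_ _] := is_material_p_plus oOmega sol t0 Ox; rewrite /material => ->.
exact: (pressure_equation oOmega sol t0 Ox).
Qed.
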